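(* Let $\mathcal{S}$ be a commutative semiring and $\Sigma$ a finite alphabet. For every expression $t\in\mathbf{MSOLEVAL}_{\mathcal{S}}$ there is a formula $\phi_t\in\mathbf{RMSOL}$ such that $WE(\phi_t,w,\sigma)=E(t,w,\sigma)$ for every word $w$ and every assignment $\sigma$ of the free variables; i.e., $\phi_t$ and $t$ define the same word function.
   Context: Word structures: a word $w=\sigma_1\cdots\sigma_n\in\Sigma^{\star}$ is represented by the structure $\mathcal{A}_w$ with universe $\{0,1,\dots,n\}$, the natural linear order $\le$, and unary predicates $P_a=\{i\in\{1,\dots,n\}:\sigma_i=a\}$ for $a\in\Sigma$. Variables range over positions of $w$ (first-order variables) and sets of positions (set variables); an assignment $\sigma$ maps free variables to these. $\mathbf{MSOLEVAL}_{\mathcal{S}}$ expressions: built inductively from monomials $\prod_{v:\phi(v)} r$ (with $r\in\mathcal{S}$ and $\phi$ an $\mathbf{MSOL}$ formula; value $r^{k}$ where $k$ is the number of elements $v$ satisfying $\phi$) closed under finite products of monomials and under sums $\sum_{\bar R:\phi(\bar R)} t$ over tuples $\bar R$ of subsets of the universe satisfying an $\mathbf{MSOL}$ formula $\phi$, where $t$ is an expression that may mention $\bar R$. Expressions may have free first-order and set variables occurring in their formulas; $E(t,w,\sigma)$ denotes the value in $\mathcal{S}$ of $t$ on $\mathcal{A}_w$ under assignment $\sigma$. Weighted MSOL ($\mathbf{WMSOL}$): formulas given by $\phi::= k\mid P_a(x)\mid\neg P_a(x)\mid x\le y\mid\neg x\le y\mid x\in X\mid x\notin X\mid\phi\vee\psi\mid\phi\wedge\psi\mid\exists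 x.\phi\mid\exists X.\phi\mid\forall x.\phi\mid\forall X.\phi$ with $k\in\mathcal{S}$, $a\in\Sigma$. Semantics $WE(\phi,w,\sigma)\in\mathcal{S}$: $WE(k)=k$; an atomic formula evaluates to $1$ if true and $0$ if false under $\sigma$; a negated atomic formula evaluates to $1$ if the atom is false and $0$ otherwise; $\vee$ is semiring sum, $\wedge$ semiring product; $\exists x$ (resp. $\exists X$) is the sum over all positions (resp. all sets of positions) of the value of the body; $\forall x$ (resp. $\forall X$) is the product over all positions (resp. all sets of positions) of the value of the body. $\mathbf{bMSOL}$: formulas $\phi::=0\mid1\mid P_a(x)\mid x\le y\mid x\in X\mid\neg\phi\mid\phi\wedge\psi\mid\forall x.\phi\mid\forall X.\phi$; their evaluation takes values in $\{0,1\}$ and coincides with the standard Boolean semantics of $\phi$ as an unweighted MSOL formula. A $\mathbf{bMSOL}$-step formula is a formula $\bigvee_{i\in I}(\phi_i\wedge k_i)$ with $I$ finite, $\phi_i\in\mathbf{bMSOL}$, $k_i\in\mathcal{S}$. $\mathbf{RMSOL}$ is the fragment of $\mathbf{WMSOL}$ in which universal second-order quantification $\forall X.\psi$ is allowed only for $\psi\in\mathbf{bMSOL}$ and universal first-order quantification $\forall x.\psi$ only for $\mathbf{bMSOL}$-step formulas $\psi$. *)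

(* Defs.v *)
From mathcomp Require Import all_boot all_order all_algebra.

Set Implicit Arguments.
Unset Strict Implicit.
Unset Printing Implicit Defensive.

Import GRing.Theory.
Local Open Scope ring_scope.

(* The universe of the word structure of [w] is {0, ..., size w}; the letters *)
(* sit at the positions 1, ..., size w, and position 0 carries no letter.     *)
Definition pos (Sigma : finType) (w : seq Sigma) : finType := 'I_(size w).+1.

Definition has_letter (Sigma : finType) (w : seq Sigma) (a : Sigma)
    (i : pos w) : bool :=
  if val i is j.+1 then onth w j == Some a else false.

(* First-order variables and set variables are two separate copies of nat.    *)
(* Assignments are total; only the values at free variables matter.           *)
Record assignment (Sigma : finType) (w : seq Sigma) := Assignment {
  fo_val : nat -> pos w;
  so_val : nat -> {set pos w}
}.

Definition upd_fo (Sigma : finType) (w : seq Sigma) (s : assignment w)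
    (x : nat) (i : pos w) : assignment w :=
  Assignment (fun y => if y == x then i else fo_val s y) (so_val s).

Definition upd_so (Sigma : finType) (w : seq Sigma) (s : assignment w)
    (X : nat) (A : {set pos w}) : assignment w :=
  Assignment (fo_val s) (fun Y => if Y == X then A else so_val s Y).

(* Simultaneous update; [index Y Rs] is out of range when [Y \notin Rs], in   *)
(* which case [nth] returns the old value.                                    *)
Definition upd_sos (Sigma : finType) (w : seq Sigma) (s : assignment w)
    (Rs : seq nat) (As : seq {set pos w}) : assignment w :=
  Assignment (fo_val s) (fun Y => nth (so_val s Y) As (index Y Rs)).

(* In lists of free variables, [inl x] is the first-order variable x and      *)
(* [inr X] is the set variable X.                                             *)
Definition var : eqType := (nat + nat)%type.

Inductive msol (Sigma : finType) :=
| MFalse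
| MTrue
| MLetter (a : Sigma) (x : nat)
| MLe (x y : nat)
| MEq (x y : nat)
| MIn (x X : nat)
| MNot (phi : msol Sigma)
| MOr (phi psi : msol Sigma)
| MAnd (phi psi : msol Sigma)
| MEx (x : nat) (phi : msol Sigma)
| MEx2 (X : nat) (phi : msol Sigma)
| MAll (x : nat) (phi : msol Sigma)
| MAll2 (X : nat) (phi : msol Sigma).

Arguments MFalse {Sigma}.
Arguments MTrue {Sigma}.
Arguments MLe {Sigma}.
Arguments MEq {Sigma}.
Arguments MIn {Sigma}.

Fixpoint msat (Sigma : finType) (phi : msol Sigma) (w : seq Sigma)
    (s : assignment w) : bool :=
  match phi with
  | MFalse => false
  | MTrue => true
  | MLetter a x => has_letter a (fo_val s x)
  | MLe x y => (fo_val s x <= fo_val s y)%N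
  | MEq x y => fo_val s x == fo_val s y
  | MIn x X => fo_val s x \in so_val s X
  | MNot p => ~~ msat p s
  | MOr p q => msat p s || msat q s
  | MAnd p q => msat p s && msat q s
  | MEx x p => [exists i, msat p (upd_fo s x i)]
  | MEx2 X p => [exists A, msat p (upd_so s X A)]
  | MAll x p => [forall i, msat p (upd_fo s x i)]
  | MAll2 X p => [forall A, msat p (upd_so s X A)]
  end.

Fixpoint mfv (Sigma : finType) (phi : msol Sigma) : seq var :=
  match phi with
  | MFalse | MTrue => [::]
  | MLetter _ x => [:: inl x]
  | MLe x y | MEq x y => [:: inl x; inl y]
  | MIn x X => [:: inl x; inr X]
  | MNot p => mfv p
  | MOr p q | MAnd p q => mfv p ++ mfv q
  | MEx x p | MAll x p => [seq z <- mfv p | z != inl x]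
  | MEx2 X p | MAll2 X p => [seq z <- mfv p | z != inr X]
  end.

(* [Monomial v phi r] is the expression \prod_(v : phi(v)) r, which binds the *)
(* first-order variable v in phi.                                             *)
Record monomial (S : comPzSemiRingType) (Sigma : finType) := Monomial {
  mono_var : nat;
  mono_cond : msol Sigma;
  mono_base : S
}.

(* [EProd ms] is a finite product of monomials; [ESum _ phi t], with tuple of *)
(* (distinct) set variables Rs, is \sum_(Rs : phi(Rs)) t and binds Rs in both *)
(* phi and t.                                                                 *)
Inductive msoleval (S : comPzSemiRingType) (Sigma : finType) :=
| EProd (ms : seq (monomial S Sigma))
| ESum (Rs : seq nat) (uniq_Rs : uniq Rs) (phi : msol Sigma)
       (t : msoleval S Sigma).

Definition mono_eval (S : comPzSemiRingType) (Sigma : finType)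
    (m : monomial S Sigma) (w : seq Sigma) (s : assignment w) : S :=
  mono_base m ^+ #|[set i : pos w | msat (mono_cond m) (upd_fo s (mono_var m) i)]|.

Fixpoint E (S : comPzSemiRingType) (Sigma : finType) (t : msoleval S Sigma)
    (w : seq Sigma) (s : assignment w) : S :=
  match t with
  | EProd ms => \prod_(m <- ms) mono_eval m s
  | ESum Rs _ phi t =>
      \sum_(As : (size Rs).-tuple {set pos w} | msat phi (upd_sos s Rs As))
         E t (upd_sos s Rs As)
  end.

Fixpoint efv (S : comPzSemiRingType) (Sigma : finType) (t : msoleval S Sigma) :
    seq var :=
  match t with
  | EProd ms =>
      flatten [seq [seq z <- mfv (mono_cond m) | z != inl (mono_var m)]
              | m <- ms]
  | ESum Rs _ phi t =>
      [seq z <- mfv phi ++ efv t | z \notin [seq inr X | X <- Rs]]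
  end.

(* Raw formulas, a common syntax for WMSOL, bMSOL and RMSOL. Negation is      *)
(* unrestricted here because bMSOL, whose formulas occur inside RMSOL, is     *)
(* closed under negation; the predicates below restrict its use.              *)
Inductive wform (S : comPzSemiRingType) (Sigma : finType) :=
| WConst (k : S)
| WLetter (a : Sigma) (x : nat)
| WLe (x y : nat)
| WIn (x X : nat)
| WNot (phi : wform S Sigma)
| WOr (phi psi : wform S Sigma)
| WAnd (phi psi : wform S Sigma)
| WEx (x : nat) (phi : wform S Sigma)
| WEx2 (X : nat) (phi : wform S Sigma)
| WAll (x : nat) (phi : wform S Sigma)
| WAll2 (X : nat) (phi : wform S Sigma).

Arguments WConst {S Sigma}.
Arguments WLetter {S Sigma}.
Arguments WLe {S Sigma}.
Arguments WIn {S Sigma}.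

Definition is_atom (S : comPzSemiRingType) (Sigma : finType)
    (phi : wform S Sigma) : bool :=
  match phi with
  | WLetter _ _ | WLe _ _ | WIn _ _ => true
  | _ => false
  end.

Fixpoint bMSOL (S : comPzSemiRingType) (Sigma : finType) (phi : wform S Sigma) :
    bool :=
  match phi with
  | WConst k => (k == 0) || (k == 1)
  | WLetter _ _ | WLe _ _ | WIn _ _ => true
  | WNot p => bMSOL p
  | WAnd p q => bMSOL p && bMSOL q
  | WAll _ p | WAll2 _ p => bMSOL p
  | WOr _ _ | WEx _ _ | WEx2 _ _ => false
  end.

(* Nonempty disjunctions, with any bracketing, of formulas phi_i /\ k_i; the  *)
(* empty one is covered by 0 /\ 0.                                            *)
Fixpoint bMSOL_step (S : comPzSemiRingType) (Sigma : finType)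
    (phi : wform S Sigma) : bool :=
  match phi with
  | WOr p q => bMSOL_step p && bMSOL_step q
  | WAnd p (WConst _) => bMSOL p
  | _ => false
  end.

(* Negation is on atoms or, so that bMSOL is part of WMSOL, on bMSOL formulas *)
(* (atoms are themselves bMSOL formulas).                                     *)
Fixpoint WMSOL (S : comPzSemiRingType) (Sigma : finType) (phi : wform S Sigma) :
    bool :=
  match phi with
  | WConst _ | WLetter _ _ | WLe _ _ | WIn _ _ => true
  | WNot p => bMSOL p
  | WOr p q | WAnd p q => WMSOL p && WMSOL q
  | WEx _ p | WEx2 _ p | WAll _ p | WAll2 _ p => WMSOL p
  end.

(* General negation enters only through the bodies of universal quantifiers.  *)
Fixpoint RMSOL (S : comPzSemiRingType) (Sigma : finType) (phi : wform S Sigma) :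
    bool :=
  match phi with
  | WConst _ | WLetter _ _ | WLe _ _ | WIn _ _ => true
  | WNot p => is_atom p
  | WOr p q | WAnd p q => RMSOL p && RMSOL q
  | WEx _ p | WEx2 _ p => RMSOL p
  | WAll _ p => bMSOL_step p
  | WAll2 _ p => bMSOL p
  end.

(* The clause for negation is meaningful on formulas with values in {0, 1};   *)
(* see [WE_bMSOL].                                                            *)
Fixpoint WE (S : comPzSemiRingType) (Sigma : finType) (phi : wform S Sigma)
    (w : seq Sigma) (s : assignment w) : S :=
  match phi with
  | WConst k => k
  | WLetter a x => (has_letter a (fo_val s x))%:R
  | WLe x y => (fo_val s x <= fo_val s y)%N%:R
  | WIn x X => (fo_val s x \in so_val s X)%:R
  | WNot p => (WE p s == 0)%:R
  | WOr p q => WE p s + WE q s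
  | WAnd p q => WE p s * WE q s
  | WEx x p => \sum_(i : pos w) WE p (upd_fo s x i)
  | WEx2 X p => \sum_(A : {set pos w}) WE p (upd_so s X A)
  | WAll x p => \prod_(i : pos w) WE p (upd_fo s x i)
  | WAll2 X p => \prod_(A : {set pos w}) WE p (upd_so s X A)
  end.

Fixpoint wfv (S : comPzSemiRingType) (Sigma : finType) (phi : wform S Sigma) :
    seq var :=
  match phi with
  | WConst _ => [::]
  | WLetter _ x => [:: inl x]
  | WLe x y => [:: inl x; inl y]
  | WIn x X => [:: inl x; inr X]
  | WNot p => wfv p
  | WOr p q | WAnd p q => wfv p ++ wfv q
  | WEx x p | WAll x p => [seq z <- wfv p | z != inl x]
  | WEx2 X p | WAll2 X p => [seq z <- wfv p | z != inr X]
  end.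

Fixpoint msol_of (S : comPzSemiRingType) (Sigma : finType)
    (phi : wform S Sigma) : msol Sigma :=
  match phi with
  | WConst k => if k == 0 then MFalse else MTrue
  | WLetter a x => MLetter a x
  | WLe x y => MLe x y
  | WIn x X => MIn x X
  | WNot p => MNot (msol_of p)
  | WOr p q => MOr (msol_of p) (msol_of q)
  | WAnd p q => MAnd (msol_of p) (msol_of q)
  | WEx x p => MEx x (msol_of p)
  | WEx2 X p => MEx2 X (msol_of p)
  | WAll x p => MAll x (msol_of p)
  | WAll2 X p => MAll2 X (msol_of p)
  end.

Lemma prod_bool (S : comPzSemiRingType) (I : finType) (b : I -> bool) :
  \prod_(i : I) (b i)%:R = [forall i, b i]%:R :> S.
Proof.
have [/forallP bT | /forallPn [i /negbTE bi]] := boolP [forall i, b i].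
  by rewrite big1 // => i _; rewrite bT.
by rewrite (bigD1 i) //= bi mul0r.
Qed.

Lemma WE_bMSOL (S : comPzSemiRingType) (Sigma : finType) (phi : wform S Sigma)
    (w : seq Sigma) (s : assignment w) :
  bMSOL phi -> WE phi s = (msat (msol_of phi) s)%:R.
Proof.
have [S0 _|S1] := eqVneq (1 : S) 0.
  have all0 (x : S) : x = 0 by rewrite -[x]mul1r S0 mul0r.
  by rewrite [LHS]all0 [RHS]all0.
elim: phi s => //=.
- by move=> k s /orP[] /eqP->; rewrite ?eqxx ?(negbTE S1).
- move=> p IH s /IH->; case: (msat _ _) => /=; last by rewrite eqxx.
  by rewrite (negbTE S1).
- by move=> p IHp q IHq s /andP[/IHp-> /IHq->]; rewrite -natrM mulnb.
- by move=> x p IH s bp; rewrite -prod_bool; apply: eq_bigr => i _; apply: IH.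
- by move=> X p IH s bp; rewrite -prod_bool; apply: eq_bigr => A _; apply: IH.
Qed.

Lemma bMSOL_WMSOL (S : comPzSemiRingType) (Sigma : finType)
    (phi : wform S Sigma) : bMSOL phi -> WMSOL phi.
Proof. by elim: phi => //= p IHp q IHq /andP[/IHp-> /IHq->]. Qed.

Lemma RMSOL_WMSOL (S : comPzSemiRingType) (Sigma : finType)
    (phi : wform S Sigma) : RMSOL phi -> WMSOL phi.
Proof.
elim: phi => //=.
- by case.
- by move=> p IHp q IHq /andP[/IHp-> /IHq->].
- by move=> p IHp q IHq /andP[/IHp-> /IHq->].
- move=> _ p _; elim: p => //=.
    by move=> p IHp q IHq /andP[/IHp-> /IHq->].
  by move=> p _ [] // k _ /bMSOL_WMSOL->.
- by move=> _ p _; apply: bMSOL_WMSOL.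
Qed.

(* Main.v *)
Require Import Defs.
From mathcomp Require Import all_boot all_order all_algebra.

(** An MSOL formula translates into bMSOL by De Morgan's laws, with value its
    truth value in {0, 1}.  A monomial [\prod_(v : phi(v)) r] becomes the
    step formula quantification [forall v. (phi /\ r) \/ (~ phi /\ 1)], and a
    sum over tuples of sets becomes a block of existential set quantifiers over
    [phi /\ t].  As RMSOL allows general bMSOL formulas only below a universal
    quantifier, the guard [phi] is written [forall X. phi] for a fresh [X]. *)

Set Implicit Arguments.
Unset Strict Implicit.
Unset Printing Implicit Defensive.

Import GRing.Theory.
Local Open Scope ring_scope.

Section Agreement.

Variables (Sigma : finType) (w : seq Sigma).
Implicit Types (s : assignment w) (vs : seq var).

(** Assignments contain functions, so two ways of updating them are compared pointwise, on the
    variables that matter, rather than by equality. *)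
Definition agree vs s s' : Prop :=
  (forall x, inl x \in vs -> fo_val s x = fo_val s' x) /\
  (forall X, inr X \in vs -> so_val s X = so_val s' X).

Lemma sub_agree vs1 vs2 s s' :
  {subset vs1 <= vs2} -> agree vs2 s s' -> agree vs1 s s'.
Proof. by move=> sub [fo so]; split=> z /sub; [apply: fo | apply: so]. Qed.

Lemma agree_upd_fo vs s s' x i :
  agree [seq z <- vs | z != inl x] s s' ->
  agree vs (upd_fo s x i) (upd_fo s' x i).
Proof.
move=> [fo so]; split=> [y yv | X Xv] /=.
  case: eqP => // /eqP yx; apply: fo; rewrite mem_filter yv andbT.
  by apply: contra yx => /eqP[->].
by apply: so; rewrite mem_filter Xv.
Qed.

Lemma agree_upd_so vs s s' X A :
  agree [seq z <- vs | z != inr X] s s' ->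
  agree vs (upd_so s X A) (upd_so s' X A).
Proof.
move=> [fo so]; split=> [x xv | Y Yv] /=.
  by apply: fo; rewrite mem_filter xv.
case: eqP => // /eqP YX; apply: so; rewrite mem_filter Yv andbT.
by apply: contra YX => /eqP[->].
Qed.

Lemma agree_upd_so_fresh vs s X A :
  inr X \notin vs -> agree vs (upd_so s X A) s.
Proof. by move=> Xvs; split=> //= Y Yvs; case: eqP Xvs Yvs => // -> /negP. Qed.

(** Coincidence lemma, by induction on [p]: below a quantifier, updating both assignments alike
    restores agreement at the bound variable, which [wfv] filters out. *)
Lemma WE_agree (S : comPzSemiRingType) (p : wform S Sigma) s s' :
  agree (wfv p) s s' -> WE p s = WE p s'.
Proof.
elim: p s s' => //=.
- by move=> a x s s' [fo _]; rewrite fo ?mem_head.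
- by move=> x y s s' [fo _]; rewrite !fo ?inE ?eqxx ?orbT.
- by move=> x X s s' [fo so]; rewrite fo ?so ?inE ?eqxx ?orbT.
- by move=> p IH s s' /IH->.
- move=> p IHp q IHq s s' ag.
  by congr (_ + _); [apply: IHp | apply: IHq]; apply: sub_agree ag => z;
    rewrite mem_cat => ->; rewrite ?orbT.
- move=> p IHp q IHq s s' ag.
  by congr (_ * _); [apply: IHp | apply: IHq]; apply: sub_agree ag => z;
    rewrite mem_cat => ->; rewrite ?orbT.
- by move=> x p IH s s' ag; apply: eq_bigr => i _; apply/IH/agree_upd_fo.
- by move=> X p IH s s' ag; apply: eq_bigr => A _; apply/IH/agree_upd_so.
- by move=> x p IH s s' ag; apply: eq_bigr => i _; apply/IH/agree_upd_fo.
- by move=> X p IH s s' ag; apply: eq_bigr => A _; apply/IH/agree_upd_so.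
Qed.

End Agreement.

Definition fresh_so (vs : seq var) : nat :=
  (\max_(z <- vs) if z is inr X then X else 0%N).+1.

Lemma fresh_soP vs : inr (fresh_so vs) \notin vs.
Proof.
apply/negP => /(@leq_bigmax_seq _ _ xpredT
  (fun z : var => if z is inr X then X else 0%N)) /(_ isT).
by rewrite ltnn.
Qed.

Section Translation.

Variables (S : comPzSemiRingType) (Sigma : finType).
Implicit Types (phi : msol Sigma) (p : wform S Sigma).

(** Equality is not an atom of bMSOL; it is expressed by antisymmetry of the order. *)
Fixpoint bform phi : wform S Sigma :=
  match phi with
  | MFalse => WConst 0
  | MTrue => WConst 1
  | MLetter a x => WLetter a x
  | MLe x y => WLe x y
  | MEq x y => WAnd (WLe x y) (WLe y x)
  | MIn x X => WIn x X
  | MNot p => WNot (bform p)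
  | MOr p q => WNot (WAnd (WNot (bform p)) (WNot (bform q)))
  | MAnd p q => WAnd (bform p) (bform q)
  | MEx x p => WNot (WAll x (WNot (bform p)))
  | MEx2 X p => WNot (WAll2 X (WNot (bform p)))
  | MAll x p => WAll x (bform p)
  | MAll2 X p => WAll2 X (bform p)
  end.

Lemma bMSOL_bform phi : bMSOL (bform phi).
Proof. by elim: phi => //= [||p -> q|p -> q] //; rewrite eqxx ?orbT. Qed.

Lemma wfv_bform phi : wfv (bform phi) =i mfv phi.
Proof.
elim: phi => //=.
- by move=> x y z; rewrite !inE; do 2!case: (z == _).
- by move=> p IHp q IHq z; rewrite !mem_cat IHp IHq.
- by move=> p IHp q IHq z; rewrite !mem_cat IHp IHq.
- by move=> x p IH z; rewrite !mem_filter IH.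
- by move=> X p IH z; rewrite !mem_filter IH.
- by move=> x p IH z; rewrite !mem_filter IH.
- by move=> X p IH z; rewrite !mem_filter IH.
Qed.

Lemma WE_bform phi (w : seq Sigma) (s : assignment w) :
  WE (bform phi) s = (msat phi s)%:R.
Proof.
(* If 1 = 0, comparison with 0 cannot tell true from false, but then all values coincide. *)
have [S0|S1] := eqVneq (1 : S) 0.
  have all0 (x : S) : x = 0 by rewrite -[x]mul1r S0 mul0r.
  by rewrite [LHS]all0 [RHS]all0.
have natb_eq0 (b : bool) : (b%:R == 0 :> S) = ~~ b.
  by case: b; rewrite ?eqxx ?(negbTE S1).
elim: phi s => //=.
- by move=> x y s; rewrite -natrM mulnb -eqn_leq.
- by move=> p IH s; rewrite IH natb_eq0.
- by move=> p IHp q IHq s; rewrite IHp IHq !natb_eq0 -natrM mulnb natb_eq0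
    negb_and !negbK.
- by move=> p IHp q IHq s; rewrite IHp IHq -natrM mulnb.
- move=> x p IH s; under eq_bigr do rewrite IH natb_eq0.
  by rewrite prod_bool natb_eq0 negb_forall; under eq_existsb do rewrite negbK.
- move=> X p IH s; under eq_bigr do rewrite IH natb_eq0.
  by rewrite prod_bool natb_eq0 negb_forall; under eq_existsb do rewrite negbK.
- by move=> x p IH s; under eq_bigr do rewrite IH; rewrite prod_bool.
- by move=> X p IH s; under eq_bigr do rewrite IH; rewrite prod_bool.
Qed.

Definition guard phi : wform S Sigma :=
  WAll2 (fresh_so (wfv (bform phi))) (bform phi).

Lemma wfv_guard phi : {subset wfv (guard phi) <= mfv phi}.
Proof. by move=> z; rewrite mem_filter wfv_bform => /andP[]. Qed.

(** By freshness all factors of the product equal the same element of {0, 1}, and a nonempty product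
    of copies of it is that element again. *)
Lemma WE_guard phi (w : seq Sigma) (s : assignment w) :
  WE (guard phi) s = (msat phi s)%:R.
Proof.
rewrite /=; under eq_bigr => A _.
  rewrite (WE_agree (agree_upd_so_fresh _ _ (fresh_soP _))) WE_bform.
  over.
rewrite prod_bool; congr (nat_of_bool _)%:R.
(* [set0] witnesses that the product over sets is nonempty. *)
by apply/forallP/idP => [/(_ set0)|].
Qed.

Definition mono_form (m : monomial S Sigma) : wform S Sigma :=
  WAll (mono_var m)
    (WOr (WAnd (bform (mono_cond m)) (WConst (mono_base m)))
         (WAnd (bform (MNot (mono_cond m))) (WConst 1))).

Lemma RMSOL_mono_form m : RMSOL (mono_form m).
Proof. by rewrite /= bMSOL_bform. Qed.

Lemma wfv_mono_form m :
  {subset wfv (mono_form m) <=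
     [seq z <- mfv (mono_cond m) | z != inl (mono_var m)]}.
Proof. by move=> z; rewrite !mem_filter !mem_cat !wfv_bform !orbF orbb. Qed.

(** The two disjuncts exclude each other, so the body has value r at the positions satisfying the
    condition and 1 elsewhere; the product is r to the number of the former. *)
Lemma WE_mono_form m (w : seq Sigma) (s : assignment w) :
  WE (mono_form m) s = mono_eval m s.
Proof.
rewrite /mono_eval -prodr_const [RHS]big_mkcond; apply: eq_bigr => i _.
rewrite -[LHS]/(WE (bform (mono_cond m)) _ * _
                + WE (bform (MNot (mono_cond m))) _ * _).
rewrite !WE_bform inE /=.
by case: (msat _ _); rewrite /= ?mul1r ?mul0r ?mulr1 ?addr0 ?add0r.
Qed.

Lemma wfv_ex2s (Rs : seq nat) p z :
  (z \in wfv (foldr (@WEx2 S Sigma) p Rs)) =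
  (z \notin [seq inr X | X <- Rs]) && (z \in wfv p).
Proof.
by elim: Rs => //= R Rs IH; rewrite mem_filter IH inE negb_or andbA.
Qed.

Lemma RMSOL_ex2s (Rs : seq nat) p :
  RMSOL (foldr (@WEx2 S Sigma) p Rs) = RMSOL p.
Proof. by elim: Rs. Qed.

(** Peels off the first set of a tuple, to match the outermost quantifier of a block. *)
Lemma big_tuple_cons (T : finType) n (F : n.+1.-tuple T -> S) :
  \sum_(u : n.+1.-tuple T) F u =
  \sum_(x : T) \sum_(u : n.-tuple T) F (cons_tuple x u).
Proof.
rewrite pair_bigA (reindex (fun q : T * n.-tuple T => cons_tuple q.1 q.2)) //=.
exists (fun u => (thead u, behead_tuple u)) => [[x u] _ | u _] /=.
  by congr (_, _); apply: val_inj.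
by case/tupleP: u => x u; apply: val_inj.
Qed.

(** Nested quantifiers update one variable at a time, [upd_sos] all at once; the results agree
    because the variables are distinct. *)
Lemma WE_ex2s (Rs : seq nat) p (w : seq Sigma) (s : assignment w) :
  uniq Rs ->
  WE (foldr (@WEx2 S Sigma) p Rs) s =
  \sum_(As : (size Rs).-tuple {set pos w}) WE p (upd_sos s Rs As).
Proof.
elim: Rs s => [|R Rs IH] s /= => [_|/andP[RRs uRs]].
  rewrite (big_pred1 [tuple]) => [|u]; last exact/esym/eqP/tuple0.
  by apply: WE_agree.
rewrite big_tuple_cons; apply: eq_bigr => A _; rewrite IH //.
apply: eq_bigr => As _; apply: WE_agree; split=> //= X _.
(* At [R] itself the inner update looks up an index out of range, as [R] is not in [Rs], and returns
   the default, which is the set [A] just assigned. *)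
have [RX | //] := eqVneq R X.
by rewrite nth_default // memNindex ?size_tuple -?RX.
Qed.

End Translation.

Theorem theorem17 (S : comPzSemiRingType) (Sigma : finType)
    (t : msoleval S Sigma) :
  exists phi : wform S Sigma,
    [/\ RMSOL phi,
        {subset wfv phi <= efv t}
      & forall (w : seq Sigma) (s : assignment w), WE phi s = E t s].
Proof.
elim: t => [ms | Rs uRs phi t [p [Rp fvp WEp]]].
  exists (foldr (fun m => WAnd (mono_form m)) (WConst 1) ms).
  elim: ms => [|m ms [Rms fvms WEms]]; first by split=> //= w s; rewrite big_nil.
  split=> [|z|w s].
  - by rewrite [RMSOL _]/= Rms andbT; apply: RMSOL_mono_form.
  - rewrite [wfv _]/= [efv _]/= mem_cat => /orP[/wfv_mono_form zm | /fvms zms].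
      by rewrite mem_cat zm.
    (* The flattened tail is convertible to [efv (EProd ms)]; refolding it lets the induction
       hypothesis apply. *)
    by rewrite mem_cat orbC -[X in X || _]/(z \in efv (EProd ms)) zms.
  - by rewrite [E _ _]/= big_cons -WE_mono_form -[X in _ * X]/(E (EProd ms) s) -WEms.
exists (foldr (@WEx2 S Sigma) (WAnd (guard S phi) p) Rs); split=> [|z|w s].
- by rewrite RMSOL_ex2s /= bMSOL_bform.
- rewrite wfv_ex2s mem_filter => /andP[-> /=]; rewrite !mem_cat.
  by case/orP => [/wfv_guard -> // | /fvp ->]; rewrite orbT.
(* The restricted sum becomes a full sum with zero terms where [phi] fails, which is what the guard
   factor produces. *)
- rewrite WE_ex2s //= [RHS]big_mkcond; apply: eq_bigr => As _.
  rewrite -[X in X * _]/(WE (guard S phi) _) WE_guard WEp.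
  by case: ifP => _; rewrite ?mul1r ?mul0r.
Qed.
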